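(* Let $A, B \in \mathbb{P}$ and $t \in [0,1]$. Then the nonlinear equation $$I = (1-t)(A \# X^{-1}) + t (B \# X^{-1})$$ has a unique positive definite solution $X \in \mathbb{P}$, namely $X = A \diamond_t B$.
   Context: $\mathbb{P}$ is the set of positive definite operators, i.e. bounded positive invertible operators on a complex Hilbert space; $I$ is the identity operator. For $A, B \in \mathbb{P}$, the geometric mean is $$A \# B = A^{1/2}(A^{-1/2} B A^{-1/2})^{1/2} A^{1/2}.$$ For $t \in [0,1]$, $$A \diamond_t B = (1-t)^2 A + t^2 B + t(1-t)\left[ A(A^{-1} \# B) + (A^{-1} \# B) A \right],$$ which is also written $(1-t)^2 A + t^2 B + t(1-t)[(AB)^{1/2} + (BA)^{1/2}]$ with $(AB)^{1/2} = A(A^{-1} \# B)$ and $(BA)^{1/2} = (A^{-1} \# B)A$. *)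

(* Defs.v *)
From HB Require Import structures.
From mathcomp Require Import all_boot all_order all_algebra.
From mathcomp Require Import complex.
From mathcomp Require Import all_classical all_reals all_analysis.

Set Implicit Arguments.
Unset Strict Implicit.
Unset Printing Implicit Defensive.

Import Order.TTheory GRing.Theory Num.Theory Num.Def.
Import numFieldNormedType.Exports.

Local Open Scope ring_scope.
Local Open Scope complex_scope.
Local Open Scope classical_set_scope.

(* A complex Hilbert space: a complete normed module over R[i], R a model of
   the real numbers, whose norm comes from an inner product. [{dot H for conjC}]
   is linear in the first argument and conjugate-linear in the second one. *)
HB.mixin Record CompleteNormedModule_isHilbert (R : realType) H
    of CompleteNormedModule R[i] H := {
  inner : {dot H for (@conjC R[i])} ;
  sqr_norm_inner : forall x : H, `|x| ^+ 2 = inner x x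
}.

#[short(type="hilbertType")]
HB.structure Definition Hilbert (R : realType) :=
  {H of CompleteNormedModule R[i] H & CompleteNormedModule_isHilbert R H}.

Section Operators.
Context {R : realType} {H : hilbertType R}.

(* Operators are elements of the lmodType H -> H, with the pointwise sum and
   scaling; their product is [\o] and the identity operator is [idfun]. *)
Implicit Types A B S : H -> H.

Definition bounded_op A :=
  linear A /\ exists M : R[i], forall x, `|A x| <= M * `|x|.

(* The order of R[i] makes 0 <= z say that z is real and nonnegative. *)
Definition positive_op A := forall x, 0 <= inner (A x) x.

Definition is_inverse_op A B :=
  [/\ bounded_op B, A \o B = idfun & B \o A = idfun].

Definition posdef A :=
  [/\ bounded_op A, positive_op A & exists B, is_inverse_op A B].

Definition is_sqrt_op A S :=
  [/\ bounded_op S, positive_op S & S \o S = A].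

(* [inv_op A] is meaningful for invertible A and [sqrt_op A] for positive
   bounded A; outside these domains they are the dummy value [idfun]. *)
Definition inv_op A : H -> H := xget (idfun : H -> H) [set B | is_inverse_op A B].

Definition sqrt_op A : H -> H := xget (idfun : H -> H) [set S | is_sqrt_op A S].

Definition gmean A B : H -> H :=
  let rA := sqrt_op A in
  let rAV := inv_op (sqrt_op A) in
  rA \o sqrt_op (rAV \o B \o rAV) \o rA.

Definition diamond (t : R) A B : H -> H :=
  let G := gmean (inv_op A) B in
  ((1 - t) ^+ 2)%:C *: A + (t ^+ 2)%:C *: B
    + (t * (1 - t))%:C *: ((A \o G) + (G \o A)).

End Operators.

(* Main.v *)
(** The mean [A # B] is the unique positive definite solution [G] of the
    Riccati equation [G A^-1 G = B].  Put [G = A^-1 # B], so that [B = G A G],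
    and [C = (1 - t) I + t G]; then the [t]-mean of [A] and [B] is [C A C].
    For [X = C A C] the Riccati equations of [A # X^-1] and [B # X^-1] are
    solved by [C^-1] and [C^-1 G], whose weighted sum is [C^-1 C = I].
    Conversely, if [P = A # X^-1] and [Q = B # X^-1] satisfy
    [I = (1 - t) P + t Q], then [P] and [Q] commute (for [t <> 0]), so
    [K = P^-1 Q] is positive definite, and [P A^-1 P = X^-1 = Q B^-1 Q] gives
    [K A K = B]; hence [K = G], [P = C^-1] and [X = C A C].

    Inverses and square roots of positive definite operators come from
    contractions: some multiple [c A] has the form [I - T] with [|T| < 1]. *)

Require Import Defs.
From mathcomp Require Import all_boot all_order all_algebra.
From mathcomp Require Import complex.
From mathcomp Require Import all_classical all_reals all_analysis.
From mathcomp Require Import ring lra.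

Set Implicit Arguments.
Unset Strict Implicit.
Unset Printing Implicit Defensive.

Import Order.TTheory GRing.Theory Num.Theory.
Import numFieldNormedType.Exports.
Local Open Scope ring_scope.
Local Open Scope complex_scope.

(** * Real inner product and norm of a complex Hilbert space *)

Section RealStructure.
Context {R : realType} {H : hilbertType R}.
Implicit Types (x y z : H) (c : R).

(** Taking real parts puts the estimates in the ordered field [R]; imaginary parts come back by
    multiplying an argument by ['i], as in [ripir]. *)
Definition rip x y : R := complex.Re (inner x y).
Definition nrm x : R := complex.Re `|x|.

Lemma innerDl x y z : inner (x + y) z = inner x z + inner y z.
Proof. by rewrite linearDl. Qed.

Lemma innerZl (a : R[i]) x y : inner (a *: x) y = a * inner x y.
Proof. by rewrite linearZl_LR. Qed.

Lemma innerC x y : inner x y = (inner y x)^*.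
Proof. by rewrite (hermC inner) /= expr0 mul1r. Qed.

Lemma ripC x y : rip x y = rip y x.
Proof. by rewrite /rip innerC; case: (inner y x). Qed.

Lemma ripDl x y z : rip (x + y) z = rip x z + rip y z.
Proof. by rewrite /rip innerDl; case: (inner x z); case: (inner y z). Qed.

Lemma ripDr x y z : rip x (y + z) = rip x y + rip x z.
Proof. by rewrite ripC ripDl !(ripC x). Qed.

Lemma ripZl c x y : rip (c%:C *: x) y = c * rip x y.
Proof.
rewrite /rip innerZl; case: (inner x y) => a b /=.
by rewrite mul0r subr0.
Qed.

Lemma ripZr c x y : rip x (c%:C *: y) = c * rip x y.
Proof. by rewrite ripC ripZl ripC. Qed.

Lemma ripNl x y : rip (- x) y = - rip x y.
Proof. by rewrite -[- x]scaleN1r -(rmorphN1 (@real_complex R)) ripZl mulN1r. Qed.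

Lemma ripNr x y : rip x (- y) = - rip x y.
Proof. by rewrite ripC ripNl ripC. Qed.

Lemma rip0l x : rip 0 x = 0.
Proof. by rewrite /rip (linear0l inner). Qed.

Definition ripE := (ripDl, ripDr, ripZl, ripZr, ripNl, ripNr).

Lemma ripil x y : rip ('i *: x) y = - complex.Im (inner x y).
Proof.
rewrite /rip innerZl; case: (inner x y) => a b /=.
by rewrite mul0r mul1r sub0r.
Qed.

Lemma ripir x y : rip x ('i *: y) = complex.Im (inner x y).
Proof. by rewrite ripC ripil innerC; case: (inner x y) => a b; rewrite /= opprK. Qed.

Lemma normE x : `|x| = (nrm x)%:C.
Proof. by rewrite /nrm RRe_real // ger0_real. Qed.

Lemma nrm_ge0 x : 0 <= nrm x.
Proof. by rewrite -ler0c -normE. Qed.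

Lemma nrm_eq0 x : nrm x = 0 -> x = 0.
Proof. by move=> h; apply/eqP; rewrite -normr_eq0 normE h. Qed.

Lemma nrm0 : nrm 0 = 0.
Proof. by rewrite /nrm normr0. Qed.

Lemma nrmD x y : nrm (x + y) <= nrm x + nrm y.
Proof. by rewrite -lecR rmorphD /= -!normE ler_normD. Qed.

Lemma nrmN x : nrm (- x) = nrm x.
Proof. by rewrite /nrm normrN. Qed.

Lemma nrmZ c x : nrm (c%:C *: x) = `|c| * nrm x.
Proof.
apply: (@complexI R); rewrite rmorphM /= -!normE normrZ; congr (_ * _).
by rewrite normc_def /= expr0n /= addr0 sqrtr_sqr.
Qed.

Lemma nrmB_le x y z : nrm (x - z) <= nrm (x - y) + nrm (y - z).
Proof. by apply: le_trans (nrmD _ _); rewrite addrA subrK. Qed.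

Lemma rip_nrm x : rip x x = nrm x ^+ 2.
Proof. by rewrite /rip -sqr_norm_inner normE -rmorphXn. Qed.

Lemma CauchySchwarz_rip x y : rip x y <= nrm x * nrm y.
Proof.
have [/eqP x0|x0] := boolP (nrm x == 0).
  by rewrite x0 mul0r (nrm_eq0 x0) rip0l.
have xp : 0 < nrm x by rewrite lt_def x0 nrm_ge0.
have [/eqP y0|y0] := boolP (nrm y == 0).
  by rewrite y0 mulr0 (nrm_eq0 y0) ripC rip0l.
have yp : 0 < nrm y by rewrite lt_def y0 nrm_ge0.
(* This vector has squared norm [2 |x| |y| (|x| |y| - rip x y)]. *)
have := sqr_ge0 (nrm ((nrm y)%:C *: x - (nrm x)%:C *: y)).
rewrite -rip_nrm !ripE (ripC y x) !rip_nrm => h.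
have xyp : 0 < nrm x * nrm y by apply: mulr_gt0.
rewrite -(ler_pM2l xyp); nra.
Qed.

Lemma CauchySchwarz_absrip x y : `|rip x y| <= nrm x * nrm y.
Proof.
rewrite ler_norml CauchySchwarz_rip andbT lerNl -ripNl.
by rewrite -(nrmN x) CauchySchwarz_rip.
Qed.

End RealStructure.

(** * Sequences with geometrically decreasing steps *)

Lemma geometric_small {R : realType} (K r e : R) : 0 <= r -> r < 1 -> 0 < e ->
  exists n, K * r ^+ n < e.
Proof.
move=> r0 r1 e0.
have /cvgrPdist_lt h : ((K * r ^+ n) @[n --> \oo] --> K * 0)%classic.
  by apply: cvgMr; apply: cvg_expr; rewrite ger0_norm.
have [N _ hN] := h e e0; exists N.
have := hN N (leqnn N); rewrite /= mulr0 sub0r normrN.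
exact: le_lt_trans (ler_norm _).
Qed.

(** Replaces passages to the limit: a defect of the limit object is compared with every iterate, and
    the error terms vanish geometrically. *)
Lemma geometric_le0 {R : realType} (K r a : R) : 0 <= r -> r < 1 ->
  (forall n, a <= K * r ^+ n) -> a <= 0.
Proof.
move=> r0 r1 ha; rewrite leNgt; apply/negP => a0.
have [n hn] := geometric_small K r0 r1 a0.
by have := ha n; rewrite leNgt hn.
Qed.

Lemma geometric_cvg {R : realType} {H : hilbertType R} (u : nat -> H)
    (K r : R) : 0 <= r -> r < 1 ->
    (forall n, nrm (u n.+1 - u n) <= K * r ^+ n) ->
  exists l, forall n, nrm (u n - l) <= K / (1 - r) * r ^+ n.
Proof.
move=> r0 r1 hu; set C := K / (1 - r).
have K0 : 0 <= K by have := hu 0%N; rewrite expr0 mulr1; apply/le_trans/nrm_ge0.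
have C0 : 0 <= C by rewrite divr_ge0 // subr_ge0 ltW.
have hK : K = C * (1 - r) by rewrite /C divfK // subr_eq0 gt_eqF.
(* The factor [1 - r ^+ m] makes the induction on [m] close exactly; the bare bound [C * r ^+ n]
   would not propagate. *)
have hD n m : nrm (u n - u (n + m)%N) <= C * r ^+ n * (1 - r ^+ m).
  elim: m => [|m IH]; first by rewrite addn0 !subrr nrm0 mulr0.
  apply: le_trans (nrmB_le _ (u (n + m)%N) _) _.
  have := hu (n + m)%N; rewrite -nrmN opprB addnS hK exprD exprS => h.
  by apply: le_trans (lerD IH h) _; rewrite le_eqVlt; apply/orP; left;
    apply/eqP; ring.
have hE n m : (n <= m)%N -> nrm (u n - u m) <= C * r ^+ n.
  move=> nm; rewrite -(subnKC nm); apply: le_trans (hD _ _) _.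
  apply: ler_piMr; first by apply: mulr_ge0 => //; apply: exprn_ge0.
  by have := exprn_ge0 (m - n) r0; lra.
(* Balls of [H] have radii in [R[i]], where a positive element is real. *)
have near_ball (e : R[i]) : 0 < e -> exists2 e' : R, 0 < e' & e = e'%:C.
  move=> e0; exists (complex.Re e); last by rewrite RRe_real // gtr0_real.
  by move: e0; rewrite ltcE /= => /andP[].
have : cvg (u @ \oo)%classic.
  apply: cauchy_cvg; apply/cauchyP => _ /near_ball[e e0 ->].
  have [N hN] := geometric_small C r0 r1 e0; exists (u N), N => //= n Nn.
  rewrite -ball_normE /= normE ltcR; exact: le_lt_trans (hE _ _ Nn) hN.
move=> /cvg_ex[l /cvg_ballP hl]; exists l => n.
rewrite leNgt; apply/negP => hlt.
have e0 : 0 < nrm (u n - l) - C * r ^+ n by rewrite subr_gt0.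
have [|N _ hN] := hl (nrm (u n - l) - C * r ^+ n)%:C; first by rewrite ltcR.
have := hN (maxn n N) (leq_maxr _ _); rewrite -ball_normE /= normE ltcR.
rewrite -nrmN opprB => h1.
have h2 := hE _ _ (leq_maxl n N).
by have := nrmB_le (u n) (u (maxn n N)) l; lra.
Qed.

(** * Positive definiteness as self-adjointness with coercivity *)

Section Operators.
Context {R : realType} {H : hilbertType R}.
Implicit Types (A B S T : H -> H) (x y : H) (c : R).

Section LinearMaps.
Context {A : H -> H} (hA : linear A).

Lemma linmap0 : A 0 = 0.
Proof.
by have := hA (-1) 0 0; rewrite scaler0 add0r scaleN1r => ->; rewrite addNr.
Qed.

Lemma linmapD x y : A (x + y) = A x + A y.
Proof. by have := hA 1 x y; rewrite !scale1r. Qed.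

Lemma linmapZ (a : R[i]) x : A (a *: x) = a *: A x.
Proof. by have := hA a x 0; rewrite linmap0 !addr0. Qed.

Lemma linmapN x : A (- x) = - A x.
Proof. by rewrite -[- x]scaleN1r linmapZ scaleN1r. Qed.

Lemma linmapB x y : A (x - y) = A x - A y.
Proof. by rewrite linmapD linmapN. Qed.

End LinearMaps.

(* For a linear map, symmetry with respect to the real part of the inner product
   is the same as self-adjointness. *)
Definition spd A :=
  [/\ linear A,
      forall x y, rip (A x) y = rip x (A y),
      exists2 M, 0 < M & forall x, nrm (A x) <= M * nrm x
    & exists2 d, 0 < d & forall x, d * nrm x ^+ 2 <= rip (A x) x].

Lemma bounded_op_nrm A : bounded_op A ->
  exists2 M, 0 < M & forall x, nrm (A x) <= M * nrm x.
Proof.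
move=> [_ [M hM]]; exists (`|complex.Re M| + 1).
  by rewrite ltr_wpDl.
move=> x; have := hM x; rewrite !normE lecE => /andP[_].
case: M {hM} => a b /=; rewrite mulr0 subr0 => h.
apply: le_trans h _; rewrite ler_wpM2r ?nrm_ge0 //.
by rewrite (le_trans (ler_norm _)) // lerDl.
Qed.

Lemma nrm_bounded_op A M : linear A -> (forall x, nrm (A x) <= M * nrm x) ->
  bounded_op A.
Proof.
by move=> lA hM; split=> //; exists M%:C => x; rewrite !normE -rmorphM lecR.
Qed.

Lemma rip_ii x y : rip ('i *: x) ('i *: y) = rip x y.
Proof. by rewrite ripil -ripir scalerA -expr2 sqr_i scaleN1r ripNr opprK. Qed.

(** Polarization: [inner (A z) z] is real for all [z], and the vanishing of its imaginary part at
    [z = x + 'i *: y] is the symmetry of [A]. *)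
Lemma positive_op_selfadjoint A : linear A -> positive_op A ->
  forall x y, rip (A x) y = rip x (A y).
Proof.
move=> lA pA x y.
have Im0 z : rip (A z) ('i *: z) = 0.
  by rewrite ripir; have := pA z; rewrite lecE => /andP[/eqP].
have := Im0 (x + 'i *: y).
rewrite scalerDr (linmapD lA) !ripDl !ripDr !Im0 (linmapZ lA) rip_ii.
rewrite scalerA -expr2 sqr_i scaleN1r ripNr => h.
by rewrite [RHS]ripC; lra.
Qed.

(** The imaginary part of [inner (A x) x] is [rip (A x) ('i *: x)], which symmetry equates with its
    own opposite. *)
Lemma selfadjoint_positive_op A : linear A ->
  (forall x y, rip (A x) y = rip x (A y)) -> (forall x, 0 <= rip (A x) x) ->
  positive_op A.
Proof.
move=> lA sA pA x; rewrite lecE /= pA andbT -ripir sA (linmapZ lA).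
have : rip x ('i *: A x) = - rip ('i *: x) (A x) by rewrite ripir ripil opprK.
by rewrite -sA (linmapZ lA) ripC; move: (rip _ _) => a h; apply/eqP; lra.
Qed.

(** Coercivity combines [|x| <= K |A x|], where [K] bounds the inverse, with
    [|A x|^2 <= M rip (A x) x]. *)
Lemma posdef_spd A : posdef A -> spd A.
Proof.
move=> [bA pA [B [bB _ BA]]].
have lA : linear A by case: bA.
have sA := positive_op_selfadjoint lA pA.
have [M M0 hM] := bounded_op_nrm bA; have [K K0 hK] := bounded_op_nrm bB.
split=> //; first by exists M.
have hMK x : nrm (A x) ^+ 2 <= M * rip (A x) x.
  (* Positivity tested at this [y] bounds [2 M^-1 |A x|^2] by [rip (A x) x] plus a second-order
     term, itself at most [M^-1 |A x|^2]. *)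
  set y := x - M^-1%:C *: A x.
  have : 0 <= rip (A y) y by have := pA y; rewrite lecE => /andP[].
  rewrite /y (linmapB lA) (linmapZ lA) !ripE !rip_nrm (sA (A x)) !rip_nrm => h.
  have h2 : rip (A (A x)) (A x) <= M * nrm (A x) ^+ 2.
    apply: le_trans (CauchySchwarz_rip _ _) _.
    by rewrite expr2 mulrA ler_wpM2r ?nrm_ge0.
  have M'0 : 0 <= M^-1 by rewrite invr_ge0 ltW.
  have h3 : M^-1 * (M^-1 * rip (A (A x)) (A x)) <= M^-1 * nrm (A x) ^+ 2.
    rewrite ler_wpM2l // (le_trans (ler_wpM2l M'0 h2)) //.
    by rewrite mulrA mulVf ?gt_eqF // mul1r.
  have h4 : M^-1 * nrm (A x) ^+ 2 <= rip (A x) x by lra.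
  by rewrite -ler_pdivrMl.
exists (K ^+ 2 * M)^-1; first by rewrite invr_gt0 mulr_gt0 // exprn_gt0.
move=> x; rewrite ler_pdivrMl ?mulr_gt0 ?exprn_gt0 //.
have h1 : nrm x <= K * nrm (A x).
  by have := hK (A x); have /= -> := congr1 (fun f => f x) BA.
have h2 : nrm x ^+ 2 <= (K * nrm (A x)) ^+ 2.
  by rewrite ler_pXn2r // nnegrE ?mulr_ge0 ?nrm_ge0 // ltW.
apply: le_trans h2 _; rewrite exprMn.
by rewrite -[leRHS]mulrA ler_wpM2l ?exprn_ge0 ?(ltW K0) ?hMK.
Qed.

(** Expanding the square gives [|x|^2 - 2 c rip (A x) x + c^2 |A x|^2]. With [d = e M] and
    [c = e / M], this is at most [(1 - e^2) |x|^2]. *)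
Lemma spd_contraction A : spd A -> exists c, exists2 q,
  [/\ 0 < c, 0 <= q & q < 1] & forall x, nrm (x - c%:C *: A x) <= q * nrm x.
Proof.
move=> [lA sA [M0 M00 hM0] [d d0 hd]].
(* Enlarging the bound by [d] ensures [e <= 1]. *)
pose M := M0 + d; pose e := d / M.
have Mp : 0 < M by rewrite addr_gt0.
have hM x : nrm (A x) <= M * nrm x.
  by apply: le_trans (hM0 x) _; rewrite ler_wpM2r ?nrm_ge0 // lerDl ltW.
have e0 : 0 < e by rewrite divr_gt0.
have e1 : e <= 1 by rewrite ler_pdivrMr // mul1r lerDr ltW.
have dE : d = e * M by rewrite divfK // gt_eqF.
(* This [q] satisfies [1 - e^2 <= q^2], which avoids a square root. *)
exists (e / M), (1 - e ^+ 2 / 2).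
  by split; [rewrite divr_gt0 | nra | nra].
move=> x; set c := e / M.
have cM : c * M = e by rewrite divfK // gt_eqF.
have c0 : 0 < c by rewrite divr_gt0.
clearbody c; clearbody e.
have q0 : 0 <= 1 - e ^+ 2 / 2 by nra.
rewrite -(@ler_pXn2r _ 2) // ?nnegrE ?nrm_ge0 ?mulr_ge0 ?nrm_ge0 //.
rewrite -rip_nrm !ripE (ripC x) !rip_nrm.
have h1 : c * (e * M * nrm x ^+ 2) <= c * rip (A x) x.
  by rewrite -dE ler_wpM2l // ltW.
have h2 : (c * nrm (A x)) ^+ 2 <= (e * nrm x) ^+ 2.
  rewrite ler_pXn2r ?nnegrE ?mulr_ge0 ?nrm_ge0 ?(ltW c0) ?(ltW e0) //.
  by rewrite -cM -mulrA ler_wpM2l // ltW.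
have h3 : c * (e * M * nrm x ^+ 2) = (e * nrm x) ^+ 2.
  by rewrite exprMn -cM; ring.
rewrite h3 in h1; move: h1 h2; rewrite !exprMn.
have := sqr_ge0 (nrm x); have := sqr_ge0 (e ^+ 2 * nrm x).
rewrite exprMn; move: (nrm x ^+ 2) (rip _ _) (nrm (A x) ^+ 2) => n a b.
move=> h4 n0 h1 h2; nra.
Qed.

End Operators.

(** * Inverses by Neumann iteration, and congruences *)

Section Inverse.
Context {R : realType} {H : hilbertType R}.
Implicit Types (A B S T : H -> H) (x y : H) (c : R).

(** The iterates of [z |-> y + T z] from 0 are the partial sums of the Neumann series of
    [(I - T)^-1 y]. *)
Lemma contraction_solve T q : linear T -> 0 <= q -> q < 1 ->
  (forall x, nrm (T x) <= q * nrm x) -> forall y, exists x, x - T x = y.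
Proof.
move=> lT q0 q1 hT y; pose u n := iter n (fun z => y + T z) 0.
have uS n : u n.+1 = y + T (u n) by [].
have hu n : nrm (u n.+1 - u n) <= nrm y * q ^+ n.
  elim: n => [|n IH]; first by rewrite uS (linmap0 lT) addr0 subr0 mulr1.
  have -> : u n.+2 - u n.+1 = T (u n.+1 - u n).
    by rewrite (linmapB lT) uS [X in _ - X = _]uS opprD addrACA subrr add0r.
  rewrite (le_trans (hT _)) //.
  by rewrite exprS mulrCA ler_wpM2l.
have [l hl] := geometric_cvg q0 q1 hu; exists l.
set C := _ / _ in hl.
apply/eqP; rewrite -subr_eq0; apply/eqP/nrm_eq0/eqP.
rewrite eq_le nrm_ge0 andbT.
apply: (@geometric_le0 _ (2 * C * q) q) => // n.
have -> : l - T l - y = - (u n.+1 - l) + T (u n - l).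
  rewrite uS (linmapB lT) !opprD opprK [_ + l]addrC !addrA subrK.
  by rewrite addrAC.
apply: le_trans (nrmD _ _) _; rewrite nrmN.
have h1 := hl n.+1; have h2 := le_trans (hT _) (ler_wpM2l q0 (hl n)).
by move: h1 h2; rewrite exprS; lra.
Qed.

Lemma coercive_nrm A d : 0 < d ->
  (forall x, d * nrm x ^+ 2 <= rip (A x) x) ->
  forall x, d * nrm x <= nrm (A x).
Proof.
move=> d0 hd x; have [n0|] := eqVneq (nrm x) 0.
  by rewrite n0 mulr0 nrm_ge0.
move=> nx; have np : 0 < nrm x by rewrite lt_def nx nrm_ge0.
rewrite -(ler_pM2r np) -mulrA -expr2.
exact: le_trans (hd x) (CauchySchwarz_rip _ _).
Qed.

(** Coercivity gives injectivity and the bound [d^-1] on the inverse; surjectivity comes from the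
    contraction [T = I - c A], since [x - T x = c y] means [A x = y]. *)
Lemma spd_invertible A : spd A -> exists B, is_inverse_op A B.
Proof.
move=> sA; have [c [q [c0 q0 q1] hq]] := spd_contraction sA.
have [lA _ _ [d d0 /(coercive_nrm d0) hd]] := sA.
have injA x y : A x = A y -> x = y.
  move=> e; apply/eqP; rewrite -subr_eq0; apply/eqP/nrm_eq0/eqP.
  have := hd (x - y); rewrite (linmapB lA) e subrr nrm0 pmulr_rle0 //.
  by rewrite eq_le nrm_ge0 andbT.
have lT : linear (fun x => x - c%:C *: A x).
  move=> a x y; rewrite (linmapD lA) (linmapZ lA) !scalerDr scalerN !scalerA.
  by rewrite (mulrC a) opprD addrACA.
have surA y : exists x, A x = y.
  have [x hx] := contraction_solve lT q0 q1 hq (c%:C *: y); exists x.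
  move: hx; rewrite opprB addrC subrK => /scalerI; apply.
  by rewrite eq_complex /= negb_and gt_eqF.
have [B AB] := choice surA; exists B.
have lB : linear B by move=> a x y; apply: injA; rewrite lA !AB.
split; last 2 first.
- by apply/funext => x; exact: AB.
- by apply/funext => x; apply: injA; rewrite /= AB.
apply: (@nrm_bounded_op _ _ _ d^-1) => // x.
by rewrite ler_pdivlMl // -{2}(AB x).
Qed.

Lemma spd_posdef A : spd A -> posdef A.
Proof.
move=> sA; have [lA aA [M _ hM] [d d0 hd]] := sA.
split; [exact: (nrm_bounded_op lA hM) | | exact: spd_invertible].
apply: selfadjoint_positive_op => // x; apply: le_trans (hd x).
by rewrite mulr_ge0 ?sqr_ge0 // ltW.
Qed.

Lemma inverse_op_uniq A B B' : is_inverse_op A B -> is_inverse_op A B' -> B = B'.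
Proof.
move=> [_ _ BA] [_ AB' _].
by rewrite -[B]/(B \o idfun) -AB' compA BA.
Qed.

Lemma inv_opE A B : is_inverse_op A B -> inv_op A = B.
Proof. by move=> h; apply: xget_unique => // C hC; exact: inverse_op_uniq hC h. Qed.

Lemma inv_opP A : posdef A -> is_inverse_op A (inv_op A).
Proof. by move=> [_ _ [B hB]]; rewrite (inv_opE hB). Qed.

Lemma posdef_linear A : posdef A -> linear A.
Proof. by case=> [[]]. Qed.

Lemma inv_opKl A : posdef A -> forall x, inv_op A (A x) = x.
Proof. by move=> /inv_opP[_ _ h] x; exact: (congr1 (fun f => f x) h). Qed.

Lemma inv_opKr A : posdef A -> forall x, A (inv_op A x) = x.
Proof. by move=> /inv_opP[_ h _] x; exact: (congr1 (fun f => f x) h). Qed.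

Lemma posdef_inv_op A : posdef A -> posdef (inv_op A).
Proof.
move=> pA; have [bB AB BA] := inv_opP pA; split=> //.
  have [_ sA _ _] := posdef_spd pA; have [bA posA _] := pA.
  move=> x; have h := posA (inv_op A x); rewrite inv_opKr // in h.
  by rewrite innerC conj_ge0.
by exists A; split=> //; case: pA.
Qed.

Lemma inv_opK A : posdef A -> inv_op (inv_op A) = A.
Proof.
by move=> pA; have [bB AB BA] := inv_opP pA; apply: inv_opE; split=> //; case: pA.
Qed.

Lemma posdef_congr S A : posdef S -> posdef A -> posdef (S \o A \o S).
Proof.
move=> pS pA; have [lS sS [M M0 hM] _] := posdef_spd pS.
have [bB SB BS] := inv_opP pS; have [bC AC CA] := inv_opP pA.
have [[lA [N hN]] posA _] := pA.
have [L L0 hL] := bounded_op_nrm (conj lA (ex_intro _ N hN)).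
have lSAS : linear (S \o A \o S) by move=> a x y /=; rewrite lS lA lS.
split.
- apply: (@nrm_bounded_op _ _ _ (M * (L * M))) => // x /=.
  rewrite -mulrA (le_trans (hM _)) // ler_wpM2l ?(ltW M0) //.
  rewrite -mulrA (le_trans (hL _)) // ler_wpM2l ?(ltW L0) //.
- have [_ sA _ [d d0 hd]] := posdef_spd pA.
  apply: selfadjoint_positive_op => // [x y|x] /=; first by rewrite sS sA sS.
  by rewrite sS (le_trans _ (hd _)) // mulr_ge0 ?sqr_ge0 // ltW.
- have [lC [_ _]] := bC; have [lB _] := bB.
  have [K K0 hK] := bounded_op_nrm bB; have [J J0 hJ] := bounded_op_nrm bC.
  exists (inv_op S \o inv_op A \o inv_op S); split.
  + apply: (@nrm_bounded_op _ _ _ (K * (J * K))) => [a x y|x] /=.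
      by rewrite lB lC lB.
    rewrite -mulrA (le_trans (hK _)) // ler_wpM2l ?(ltW K0) //.
    rewrite -mulrA (le_trans (hJ _)) // ler_wpM2l ?(ltW J0) //.
  + by apply/funext => x /=; rewrite (inv_opKr pS) (inv_opKr pA) (inv_opKr pS).
  + by apply/funext => x /=; rewrite (inv_opKl pS) (inv_opKl pA) (inv_opKl pS).
Qed.

End Inverse.

(** * Limit of the square root iteration *)

Section SquareRoot.
Context {R : realType} {H : hilbertType R}.
Implicit Types (A B S T : H -> H) (x y : H) (c : R).

Lemma nrmZC (a : R[i]) x : nrm (a *: x) = complex.Re `|a| * nrm x.
Proof.
by apply: (@complexI R); rewrite rmorphM /= -!normE normrZ; congr (_ * _);
  rewrite RRe_real ?normr_real.
Qed.

Lemma geometric_limit_uniq (u : nat -> H) x y (K L q : R) : 0 <= q -> q < 1 ->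
  (forall n, nrm (u n - x) <= K * q ^+ n) ->
  (forall n, nrm (u n - y) <= L * q ^+ n) -> x = y.
Proof.
move=> q0 q1 hx hy; apply/eqP; rewrite -subr_eq0; apply/eqP/nrm_eq0/eqP.
rewrite eq_le nrm_ge0 andbT; apply: (@geometric_le0 _ (K + L) q) => // n.
apply: le_trans (nrmB_le _ (u n) _) _.
by rewrite mulrDl lerD // -nrmN opprB.
Qed.

(* The map [Y |-> (T + Y^2) / 2] preserves the ball of radius [q], since
   [(q + q^2) / 2 <= q], and is [q]-Lipschitz on it. *)
Lemma sqrt_iteration T q : linear T ->
    (forall x y, rip (T x) y = rip x (T y)) -> 0 <= q -> q < 1 ->
    (forall x, nrm (T x) <= q * nrm x) ->
  exists Y : H -> H,
    [/\ linear Y, forall x y, rip (Y x) y = rip x (Y y),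
        forall x, nrm (Y x) <= q * nrm x,
        forall x, T x + Y (Y x) = Y x + Y x
      & forall B M, linear B -> (forall x, nrm (B x) <= M * nrm x) ->
          (forall x, B (T x) = T (B x)) -> forall x, B (Y x) = Y (B x)].
Proof.
move=> lT sT q0 q1 hT.
pose h : R[i] := (2^-1)%:C.
pose u n : H -> H := iter n (fun Y x => h *: (T x + Y (Y x))) (fun=> 0).
have uS n x : u n.+1 x = h *: (T x + u n (u n x)) by [].
have lu n : linear (u n).
  elim: n => [|n IH] a x y; first by rewrite scaler0 addr0.
  by rewrite !uS lT !IH scalerA mulrC -scalerA -scalerDr [a *: (_ + _)]scalerDr addrACA.
have su n x y : rip (u n x) y = rip x (u n y).
  elim: n x y => [|n IH] x y; first by rewrite rip0l ripC rip0l.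
  by rewrite !uS !ripE sT !IH.
have hN x : nrm (h *: x) = 2^-1 * nrm x by rewrite nrmZ ger0_norm.
have bu n x : nrm (u n x) <= q * nrm x.
  elim: n x => [|n IH] x; first by rewrite nrm0 mulr_ge0 ?nrm_ge0.
  rewrite uS hN ler_pdivrMl //; apply: le_trans (nrmD _ _) _.
  have h2 : nrm (u n (u n x)) <= q * nrm x.
    apply: le_trans (IH _) _; rewrite ler_wpM2l // (le_trans (IH _)) //.
    by rewrite ler_piMl ?nrm_ge0 // ltW.
  by have := hT x; lra.
have du n x : nrm (u n.+1 x - u n x) <= nrm x * q ^+ n.
  elim: n x => [|n IH] x.
    by rewrite subr0 mulr1 (le_trans (bu _ _)) // ler_piMl ?nrm_ge0 // ltW.
  (* Noncommutative difference of squares: [V^2 - U^2 = V (V - U) + (V - U) U]. Each summand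
     contributes a factor [q], and the two are averaged by [h]. *)
  have -> : u n.+2 x - u n.+1 x = h *: (u n.+1 (u n.+1 x - u n x) +
      (u n.+1 (u n x) - u n (u n x))).
    rewrite uS [X in _ - X = _]uS -scalerBr opprD addrACA subrr add0r.
    by rewrite (linmapB (lu n.+1)) addrA subrK.
  rewrite hN ler_pdivrMl //; apply: le_trans (nrmD _ _) _.
  have h1 := le_trans (bu n.+1 _) (ler_wpM2l q0 (IH x)).
  have h2 : nrm (u n.+1 (u n x) - u n (u n x)) <= q * nrm x * q ^+ n.
    by apply: le_trans (IH _) _; rewrite ler_wpM2r ?exprn_ge0.
  by apply: le_trans (lerD h1 h2) _; rewrite exprS; lra.
have /choice[Y hY] : forall x, exists l, forall n,
    nrm (u n x - l) <= nrm x / (1 - q) * q ^+ n.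
  by move=> x; exact: geometric_cvg q0 q1 (fun n => du n x).
set C := (1 - q)^-1 in hY.
have C0 : 0 <= C by rewrite invr_ge0 subr_ge0 ltW.
have qn0 n : 0 <= q ^+ n by rewrite exprn_ge0.
have lY : linear Y.
  move=> a x y; set z := a *: x + y.
  pose K := complex.Re `|a| * (nrm x * C) + nrm y * C.
  apply: (@geometric_limit_uniq (fun n => u n z) _ _ (nrm z * C) K q) => // n.
  rewrite lu opprD addrACA -scalerBr; apply: le_trans (nrmD _ _) _.
  rewrite nrmZC mulrDl lerD // -mulrA ler_wpM2l //.
  by rewrite -ler0c RRe_real ?normr_real.
have bY x : nrm (Y x) <= q * nrm x.
  rewrite -subr_le0; apply: (@geometric_le0 _ (nrm x * C) q) => // n.
  have := nrmB_le (Y x) (u n x) 0; rewrite !subr0 -(nrmN (Y x - _)) opprB => h1.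
  by have := hY x n; have := bu n x; lra.
exists Y; split=> //.
- move=> x y; apply/eqP; rewrite -subr_eq0 -normr_le0.
  apply: (@geometric_le0 _ (nrm x * C * nrm y + nrm x * (nrm y * C)) q) => // n.
  have -> : rip (Y x) y - rip x (Y y) =
      - rip (u n x - Y x) y + rip x (u n y - Y y) by rewrite !ripE su; ring.
  apply: le_trans (ler_normD _ _) _; rewrite normrN mulrDl lerD //.
    apply: le_trans (CauchySchwarz_absrip _ _) _.
    by rewrite mulrAC ler_wpM2r ?nrm_ge0.
  apply: le_trans (CauchySchwarz_absrip _ _) _.
  by rewrite -mulrA ler_wpM2l ?nrm_ge0.
- move=> x.
  (* The sequence [T x + u n (u n x)] equals [2 u n.+1 x], so it tends to both sides of the fixed
     point equation. *)
  apply: (@geometric_limit_uniq (fun n => T x + u n (u n x)) _ _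
    (q * (nrm x * C) + nrm (Y x) * C) (2 * (nrm x * C * q)) q) => // n.
    have -> : T x + u n (u n x) - (T x + Y (Y x)) =
        u n (u n x - Y x) + (u n (Y x) - Y (Y x)).
      by rewrite opprD addrACA subrr add0r (linmapB (lu n)) addrA subrK.
    apply: le_trans (nrmD _ _) _; rewrite mulrDl lerD //.
    by apply: le_trans (bu _ _) _; rewrite -[leRHS]mulrA ler_wpM2l.
  have -> : T x + u n (u n x) - (Y x + Y x) = 2%:C *: (u n.+1 x - Y x).
    rewrite uS scalerBr scalerA -rmorphM /= mulfV ?pnatr_eq0 // scale1r.
    by rewrite rmorphD /= scalerDl scale1r.
  rewrite nrmZ ger0_norm // -[leRHS]mulrA ler_wpM2l // -mulrA -exprS.
  exact: hY.
- move=> B M lB bB cB x.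
  (* [M] comes without a sign, so [|M|] serves as the bound. *)
  have M0 : 0 <= `|M| by [].
  have bB' y : nrm (B y) <= `|M| * nrm y.
    by apply: le_trans (bB _) _; rewrite ler_wpM2r ?nrm_ge0 ?ler_norm.
  have cu n y : B (u n y) = u n (B y).
    elim: n y => [|n IH] y; first by rewrite (linmap0 lB).
    by rewrite !uS (linmapZ lB) (linmapD lB) cB !IH.
  apply: (@geometric_limit_uniq (fun n => u n (B x)) _ _
    (`|M| * (nrm x * C)) (nrm (B x) * C) q) => // n.
  rewrite -cu -(linmapB lB); apply: le_trans (bB' _) _.
  by rewrite -mulrA ler_wpM2l.
Qed.

End SquareRoot.

(** * Square roots, geometric means and their Riccati equation *)

Section PositiveDefinite.
Context {R : realType} {H : hilbertType R}.
Implicit Types (A B S G : H -> H) (x y : H).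

Lemma op_eqP (A B : H -> H) : A = B <-> forall x, A x = B x.
Proof. by split=> [-> //|]; exact: funext. Qed.

(** For [T = I - c A], the equation [T + Y^2 = 2 Y] reads [(I - Y)^2 = c A], so [c^(-1/2) (I - Y)]
    is a root of [A], coercive because [|Y| <= q < 1]. The commutation clause is what makes the root
    unique. *)
Lemma posdef_sqrt_exists A : posdef A ->
  exists S, [/\ posdef S, S \o S = A
    & forall B, bounded_op B -> B \o A = A \o B -> B \o S = S \o B].
Proof.
move=> pA; have spA := posdef_spd pA; have [lA sA _ _] := spA.
have [c [q [c0 q0 q1] hq]] := spd_contraction spA.
pose T x := x - c%:C *: A x.
have lT : linear T.
  move=> a x y; rewrite /T (linmapD lA) (linmapZ lA) !scalerDr scalerN !scalerA.
  by rewrite (mulrC a) opprD addrACA.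
have sT x y : rip (T x) y = rip x (T y) by rewrite /T !ripE sA.
have [Y [lY sY bY eY cY]] := sqrt_iteration lT sT q0 q1 hq.
pose e := (Num.sqrt c)^-1; have e0 : 0 < e by rewrite invr_gt0 sqrtr_gt0.
have lIY : linear (fun x => x - Y x).
  by move=> a x y; rewrite lY scalerBr opprD addrACA.
pose S x := e%:C *: (x - Y x).
have lS : linear S.
  by move=> a x y; rewrite /S lIY scalerDr !scalerA (mulrC a).
exists S; split.
- apply: spd_posdef; split=> //.
  + by move=> x y; rewrite /S !ripE sY.
  + exists (e * (1 + q)); first by rewrite mulr_gt0 // ltr_wpDr.
    move=> x; rewrite nrmZ gtr0_norm // -mulrA ler_pM2l //.
    apply: le_trans (nrmD _ _) _; rewrite nrmN mulrDl mul1r lerD2l; exact: bY.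
  + exists (e * (1 - q)); first by rewrite mulr_gt0 // subr_gt0.
    move=> x; rewrite /S ripZl -mulrA ler_pM2l // ripDl ripNl rip_nrm.
    rewrite mulrBl mul1r lerD2l lerN2 (le_trans (CauchySchwarz_rip _ _)) //.
    by rewrite expr2 mulrA ler_wpM2r ?nrm_ge0.
- apply/op_eqP => x; rewrite /S /= (linmapZ lIY) scalerA -rmorphM /=.
  rewrite (linmapB lY) opprB.
  have -> : x - Y x + (Y (Y x) - Y x) = c%:C *: A x.
    have -> : Y (Y x) = Y x + Y x - T x by rewrite -eY [T x + _]addrC addrK.
    by rewrite /T opprB [_ + _ - Y x]addrAC addrK addrA subrK addrC subrK.
  rewrite scalerA -rmorphM /= /e -invfM -expr2 sqr_sqrtr ?ltW //.
  by rewrite mulVf ?gt_eqF // scale1r.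
- move=> B bB /op_eqP BA; have [lB _] := bB.
  have [M _ hM] := bounded_op_nrm bB.
  apply/op_eqP => x; rewrite /S /= (linmapZ lB) (linmapB lB) (cY B M) // => y.
  by rewrite /T (linmapB lB) (linmapZ lB); have /= -> := BA y.
Qed.

(* [S'] commutes with [A = S' \o S'], hence with [S], and then [y = S x - S' x]
   satisfies [S y + S' y = 0] with [S] coercive and [S'] positive. *)
Lemma posdef_sqrt_uniq A S S' : posdef S -> S \o S = A ->
  (forall B, bounded_op B -> B \o A = A \o B -> B \o S = S \o B) ->
  is_sqrt_op A S' -> S' = S.
Proof.
move=> pS SA cS [bS' pS' S'A]; have [lS' _] := bS'.
have /op_eqP /= comm : S' \o S = S \o S' by apply: cS => //; rewrite -S'A compA.
have [lS _ _ [d d0 hd]] := posdef_spd pS.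
apply/op_eqP => x; apply/esym/eqP; rewrite -subr_eq0.
set y := S x - S' x.
have hy : S y + S' y = 0.
  rewrite /y (linmapB lS) (linmapB lS') comm addrA subrK.
  by rewrite -[S (S x)]/((S \o S) x) -[S' (S' x)]/((S' \o S') x) SA S'A subrr.
have h1 := hd y; have h2 : 0 <= rip (S' y) y.
  by have := pS' y; rewrite lecE => /andP[].
have h3 : rip (S y) y + rip (S' y) y = 0 by rewrite -ripDl hy rip0l.
have h4 : nrm y ^+ 2 <= 0 by rewrite -(pmulr_rle0 _ d0); lra.
apply/eqP/nrm_eq0/eqP; rewrite -sqrf_eq0 eq_le h4; exact: sqr_ge0.
Qed.

Lemma sqrt_opP A : posdef A ->
  [/\ posdef (sqrt_op A), sqrt_op A \o sqrt_op A = A,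
      forall B, bounded_op B -> B \o A = A \o B ->
        B \o sqrt_op A = sqrt_op A \o B
    & forall S, is_sqrt_op A S -> sqrt_op A = S].
Proof.
move=> pA; have [S [pS SA cS]] := posdef_sqrt_exists pA.
have sS : is_sqrt_op A S by case: pS.
have -> : sqrt_op A = S.
  by apply: xget_unique => // S' /(posdef_sqrt_uniq pS SA cS).
by split=> // S' /(posdef_sqrt_uniq pS SA cS).
Qed.

(** [B] commutes with the root [S] of [A], so [A B = S B S] is a congruence of [B]. *)
Lemma posdef_comp_comm A B : posdef A -> posdef B -> A \o B = B \o A ->
  posdef (A \o B).
Proof.
move=> pA pB AB; have [pS SA cS _] := sqrt_opP pA.
have bB : bounded_op B by case: pB.
rewrite -SA -compA -(cS B bB (esym AB)) compA.
exact: posdef_congr.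
Qed.

Lemma posdef_comb (s t : R) A B : 0 <= s -> 0 <= t -> 0 < s + t ->
  posdef A -> posdef B -> posdef (s%:C *: A + t%:C *: B).
Proof.
move=> s0 t0 st /posdef_spd[lA sA [M M0 hM] [d d0 hd]].
move=> /posdef_spd[lB sB [N N0 hN] [e e0 he]].
(* One of the weights may vanish, as happens at [t = 0] and [t = 1]. *)
have pos (a b : R) : 0 < a -> 0 < b -> 0 < s * a + t * b.
  move=> a0 b0; move: s0; rewrite le_eqVlt => /orP[/eqP s0|s0].
    by rewrite -s0 mul0r add0r mulr_gt0 //; move: st; rewrite -s0 add0r.
  by rewrite ltr_wpDr ?mulr_gt0 // mulr_ge0 // ltW.
apply: spd_posdef; split.
- move=> a x y; rewrite !fctE lA lB !scalerDr !scalerA.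
  by rewrite (mulrC a) (mulrC a t%:C) addrACA.
- by move=> x y; rewrite !fctE !ripE sA sB.
- exists (s * M + t * N); first exact: pos.
  move=> x; apply: le_trans (nrmD _ _) _.
  by rewrite !nrmZ !ger0_norm // mulrDl -!mulrA lerD // ler_wpM2l.
- exists (s * d + t * e); first exact: pos.
  by move=> x; rewrite !fctE !ripE mulrDl -!mulrA lerD // ler_wpM2l.
Qed.

Lemma posdef_id : posdef (idfun : H -> H).
Proof.
apply: spd_posdef; split=> //; exists 1 => // x; first by rewrite mul1r.
by rewrite mul1r rip_nrm.
Qed.

Lemma posdef_gmean A B : posdef A -> posdef B -> posdef (gmean A B).
Proof.
move=> pA pB; have [pS _ _ _] := sqrt_opP pA.
apply: posdef_congr => //.
by have [] := sqrt_opP (posdef_congr (posdef_inv_op pS) pB).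
Qed.

Lemma inv_op_sqrt A : posdef A ->
  inv_op A = inv_op (sqrt_op A) \o inv_op (sqrt_op A).
Proof.
move=> pA; have [pS SA _ _] := sqrt_opP pA; have pV := posdef_inv_op pS.
apply: inv_opE; rewrite -{1}SA; split.
- by have [] := posdef_comp_comm pV pV erefl.
- by apply/op_eqP => x /=; rewrite !inv_opKr.
- by apply/op_eqP => x /=; rewrite !inv_opKl.
Qed.

(** With [S] the root of [A] and [W] the root of [S^-1 B S^-1], the product
    [(S W S) (S^-1 S^-1) (S W S)] collapses to [S W^2 S = B]. *)
Lemma gmean_Riccati A B : posdef A -> posdef B ->
  gmean A B \o inv_op A \o gmean A B = B.
Proof.
move=> pA pB; have [pS SA _ _] := sqrt_opP pA; have pV := posdef_inv_op pS.
have [_ /op_eqP WW _ _] := sqrt_opP (posdef_congr pV pB).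
apply/op_eqP => x; rewrite inv_op_sqrt // /gmean /=.
rewrite (inv_opKl pS) (inv_opKr pS).
by have /= -> := WW (sqrt_op A x); rewrite (inv_opKr pS) (inv_opKl pS).
Qed.

(** The Riccati equation says that [S^-1 G S^-1] squares to [S^-1 B S^-1], where [S] is the root of
    [A]; uniqueness of positive roots then determines [G]. *)
Lemma gmean_Riccati_uniq A B G : posdef A -> posdef G ->
  G \o inv_op A \o G = B -> gmean A B = G.
Proof.
move=> pA pG <-; have [pS _ _ _] := sqrt_opP pA; have pV := posdef_inv_op pS.
have pAV := posdef_inv_op pA.
have [_ _ _ uW] := sqrt_opP (posdef_congr pV (posdef_congr pG pAV)).
rewrite /gmean (uW (inv_op (sqrt_op A) \o G \o inv_op (sqrt_op A))).
  by apply/op_eqP => x /=; rewrite (inv_opKl pS) (inv_opKr pS).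
have [bW posW _] := posdef_congr pV pG; split=> //.
by rewrite (inv_op_sqrt pA).
Qed.

(** Substituting [B = G A G] turns the [t]-mean into the expansion of [C A C], with cross terms
    [t (1 - t) (A G + G A)]. *)
Lemma diamond_congr t A B : posdef A -> posdef B ->
  let C := (1 - t)%:C *: idfun + t%:C *: gmean (inv_op A) B in
  diamond t A B = C \o A \o C.
Proof.
move=> pA pB C; set G := gmean _ _ in C *.
have lA := posdef_linear pA.
have pG : posdef G by apply: posdef_gmean => //; exact: posdef_inv_op.
have lG := posdef_linear pG.
have /op_eqP /= hB := gmean_Riccati (posdef_inv_op pA) pB.
rewrite (inv_opK pA) -/G in hB.
apply/op_eqP => x; rewrite /diamond -/G /C !fctE /= -hB.
rewrite !(linmapD lA) !(linmapZ lA) !(linmapD lG) !(linmapZ lG).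
set a := A x; set b := A (G x).
rewrite !scalerDr !scalerA -!rmorphM /= -!expr2 (mulrC (1 - t)).
by rewrite -!addrA; congr (_ + _); rewrite addrC addrA.
Qed.

End PositiveDefinite.

(** * Existence and uniqueness for the mean equation *)

Theorem theorem6p2 (R : realType) (H : hilbertType R) (A B : H -> H) (t : R)
    (hA : posdef A) (hB : posdef B) (ht0 : 0 <= t) (ht1 : t <= 1) :
  let solves (X : H -> H) :=
    idfun = (1 - t)%:C *: gmean A (inv_op X) + t%:C *: gmean B (inv_op X) in
  [/\ posdef (diamond t A B), solves (diamond t A B)
    & forall X : H -> H, posdef X -> solves X -> X = diamond t A B].
Proof.
move=> solves.
have pAV := posdef_inv_op hA; have lA := posdef_linear hA.
have ht1' : 0 <= 1 - t by rewrite subr_ge0.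
rewrite (diamond_congr t hA hB); set G := gmean _ _.
have pG : posdef G by exact: posdef_gmean.
have lG := posdef_linear pG.
have := gmean_Riccati pAV hB; rewrite (inv_opK hA) -/G => GAG.
set C := _ + _; have CE x : C x = (1 - t)%:C *: x + t%:C *: G x by [].
have pC : posdef C by apply: posdef_comb posdef_id pG; rewrite ?subrK.
have pD := posdef_congr pC hA; set D := _ \o C in pD *.
have CG x : C (G x) = G (C x) by rewrite !CE (linmapD lG) !(linmapZ lG).
rewrite {}/solves; split=> //.
  have pCV := posdef_inv_op pC.
  have DV : inv_op D = inv_op C \o inv_op A \o inv_op C.
    have [bDV _ _] := posdef_congr pCV pAV; apply: inv_opE; split=> //.
      by apply/funext => x; rewrite /D /= (inv_opKr pC) (inv_opKr hA) (inv_opKr pC).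
    by apply/funext => x; rewrite /D /= (inv_opKl pC) (inv_opKl hA) (inv_opKl pC).
  have CVG x : inv_op C (G x) = G (inv_op C x).
    by rewrite -[in LHS](inv_opKr pC x) -CG (inv_opKl pC).
  have pQ : posdef (inv_op C \o G).
    by apply: posdef_comp_comm => //; apply/funext => x; exact: CVG.
  have -> : gmean A (inv_op D) = inv_op C by exact: gmean_Riccati_uniq.
  have -> : gmean B (inv_op D) = inv_op C \o G.
    apply: gmean_Riccati_uniq => //; rewrite DV; apply/funext => x /=.
    congr (inv_op C _); rewrite CVG; set y := inv_op C x.
    (* Write [y = A G z] with [z = G^-1 A^-1 y]; then [G A G = B] gives
       [G B^-1 G y = G z = A^-1 y]. *)
    rewrite -[in LHS](inv_opKr hA y) -[in LHS](inv_opKr pG (inv_op A y)).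
    have /= -> := congr1 (fun f => f (inv_op G (inv_op A y))) GAG.
    by rewrite (inv_opKl hB) (inv_opKr pG).
  by apply/funext => x; rewrite -[LHS](inv_opKr pC) CE -CVG.
move=> X pX; set P := gmean _ _; set Q := gmean _ _.
have pXV := posdef_inv_op pX.
have pP : posdef P by exact: posdef_gmean.
have pQ : posdef Q by exact: posdef_gmean.
have /op_eqP /= PAP := gmean_Riccati hA pXV; rewrite -/P in PAP.
have /op_eqP /= QBQ := gmean_Riccati hB pXV; rewrite -/Q in QBQ.
move=> /op_eqP /= hI; have hE x : x = (1 - t)%:C *: P x + t%:C *: Q x := hI x.
(* Once [C P = I], the inverse of [P] is [C], and inverting [P A^-1 P = X^-1] gives [X = C A C]. *)
suff CP x : C (P x) = x.
  have CV x : inv_op P x = C x.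
    by rewrite -[in RHS](inv_opKr pP x) CP.
  apply/funext => x; have -> : D x = inv_op P (A (inv_op P x)) by rewrite !CV.
  rewrite -[RHS](inv_opKr pX) -PAP.
  by rewrite (inv_opKr pP) (inv_opKl hA) (inv_opKr pP).
rewrite CE [RHS]hE; congr (_ + _).
(* What remains is [t G P = t Q]: trivial for [t = 0], where the equation says nothing about [Q],
   and otherwise a consequence of [G = P^-1 Q]. *)
have [->|t0] := eqVneq t 0; first by rewrite !scale0r.
have lP := posdef_linear pP; have lQ := posdef_linear pQ.
have QP y : Q (P y) = P (Q y).
  (* Expand [P (P y)] plus the [Q] term in two ways, applying the equation at [y] before [P] and at
     [P y] after it; the [1 - t] terms cancel and [t] is divided out. *)
  have : P y = P ((1 - t)%:C *: P y + t%:C *: Q y) by rewrite -hE.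
  rewrite (linmapD lP) !(linmapZ lP) {1}(hE (P y)) => /addrI/scalerI; apply.
  by rewrite eq_complex /= negb_and t0.
have QPV y : inv_op P (Q y) = Q (inv_op P y).
  by rewrite -[in LHS](inv_opKr pP y) QP (inv_opKl pP).
have pK : posdef (inv_op P \o Q).
  apply: posdef_comp_comm => //; first exact: posdef_inv_op.
  by apply/funext => y; exact: QPV.
have -> : G = inv_op P \o Q.
  apply: gmean_Riccati_uniq => //; rewrite (inv_opK hA).
  apply/funext => y /=; rewrite QPV; set w := inv_op P (A _).
  (* Here [Q w = B Q^-1 (Q B^-1 Q w) = B Q^-1 (P A^-1 P w)], and [P A^-1 P w = Q y] by the choice of
     [w]. *)
  rewrite -[Q w](inv_opKr hB) -[inv_op B _](inv_opKl pQ) QBQ -PAP.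
  by rewrite (inv_opKr pP) (inv_opKl hA) (inv_opKr pP) (inv_opKl pQ).
by rewrite /= QP (inv_opKl pP).
Qed.
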